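(* Let $n\ge 1$ and $C=\{c_1,\dots,c_n\}\subseteq\mathbb{R}$. Then $\Psi(C)$ is exactly the set of protrusive orderings of $C$, and the number of such orderings is $2^{n-1}$.
   Context: For a finite multiset $V$ of points in $\mathbb{R}^d$ (here $d=1$), $D_V(x)=\sum_{v\in V}\|x-v\|$ (with multiplicity). $V$ distinguishes $C$ if $D_V(c_1),\dots,D_V(c_n)$ are pairwise distinct, and then witnesses the ordering $\Sigma^C_V=(c_{\sigma(1)},\dots,c_{\sigma(n)})$ with $D_V(c_{\sigma(1)})<\dots<D_V(c_{\sigma(n)})$. $\Psi(C)$ is the set of all orderings $\Sigma^C_V$ over all finite nonempty multisets $V$ that distinguish $C$. An ordering $(x_1,\dots,x_n)$ is protrusive if for every $i\in[n-1]$, $x_{i+1}$ is not in the convex hull of $x_1,\dots,x_i$. *)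

(* Defs.v *)
From HB Require Import structures.
From mathcomp Require Import all_boot all_order all_algebra.
From mathcomp Require Import finmap multiset.
From mathcomp Require Import boolp classical_sets functions cardinality reals.
From mathcomp Require Import topology convex.

Set Implicit Arguments.
Unset Strict Implicit.
Unset Printing Implicit Defensive.

Import Order.TTheory GRing.Theory Num.Theory.

Local Open Scope classical_set_scope.
Local Open Scope ring_scope.

(* [V] coerces to the sequence of its elements repeated according to their
   multiplicities, so the sum counts multiplicities. *)
Definition sum_dist (R : realType) (V : {mset R}%mset) (x : R) : R :=
  \sum_(v <- V) `|x - v|.

Definition distinguishes (R : realType) (V : {mset R}%mset) (C : {fset R}) :
    Prop :=
  {in C &, injective (sum_dist V)}.

Definition orderings (R : realType) (C : {fset R}) : set (seq R) :=
  [set s | perm_eq s C].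

Definition witnesses (R : realType) (V : {mset R}%mset) (C : {fset R})
    (s : seq R) : Prop :=
  orderings C s /\ sorted (fun x y => sum_dist V x < sum_dist V y) s.

Definition Psi (R : realType) (C : {fset R}) : set (seq R) :=
  [set s | exists V : {mset R}%mset,
             [/\ V != mset0, distinguishes V C & witnesses V C s]].

Definition convex_hull (R : realType) (A : set R) : set R :=
  smallest (@convex_set R R^o) A.

(* [nth 0 s i] is the point x_(i+1) of the ordering and [take i s] is
   (x_1, ..., x_i). *)
Definition protrusive (R : realType) (s : seq R) : Prop :=
  forall i : nat, (0 < i < size s)%N ->
    ~ convex_hull [set x | x \in take i s] (nth 0 s i).

Definition protrusive_orderings (R : realType) (C : {fset R}) : set (seq R) :=
  [set s | orderings C s /\ protrusive s].

(* Main.v *)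
(** A sum of distances is convex, so a point in the hull of a set is at most as
    far as some point of the set: witnessed orderings are protrusive.
    Conversely, build the multiset along a protrusive ordering: when the next
    point y lies outside the hull [p, q] of the previous ones, adding many copies
    of the pair p, q shifts all previous values by the same constant and pushes
    the value at y above them.  For the count, the last point of a protrusive
    ordering is the minimum or the maximum of C. *)

Require Import Defs.
From HB Require Import structures.
From mathcomp Require Import all_boot all_order all_algebra.
From mathcomp Require Import finmap multiset.
From mathcomp Require Import boolp classical_sets functions cardinality reals.
From mathcomp Require Import interval_inference convex ring lra.

Set Implicit Arguments.
Unset Strict Implicit.
Unset Printing Implicit Defensive.

Local Open Scope classical_set_scope.
Local Open Scope card_scope.

Import Order.TTheory GRing.Theory Num.Theory.

Section ConvexHull.
Local Open Scope ring_scope.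
Variable R : realType.
Implicit Types (x y z p q : R) (s : seq R).

Lemma convex_set_realP (B : set R) : @convex_set R R^o B <->
  forall x z k : R, 0 <= k -> k <= 1 -> B x -> B z -> B (k * x + (1 - k) * z).
Proof.
split=> [cB x z k k0 k1 Bx Bz|cB x z l].
  by have := cB x z (Itv01 k0 k1); rewrite !inE => /(_ Bx Bz).
by rewrite !inE; exact: (cB x z l%:num).
Qed.

(** On the line the segments spanned by pairs of points of [A] already fill out a convex set, so
    hull membership reduces to lying between two points of [A]. *)
Lemma convex_hull_realP (A : set R) y :
  convex_hull A y <-> exists p q, [/\ A p, A q & p <= y <= q].
Proof.
split=> [hAy|[p [q [Ap Aq /andP[py yq]]]] B [/convex_set_realP cB AB]]; last first.
  have [eqpq|neqpq] := eqVneq p q.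
    rewrite (_ : y = p); first exact: AB.
    by apply/eqP; rewrite eq_le py eqpq yq.
  have ltpq : 0 < q - p by rewrite subr_gt0 lt_neqAle neqpq (le_trans py yq).
  (* [(q - y) / (q - p)] is the weight of [p] when [y] is written as a convex combination of [p] and
     [q]. *)
  have k0 : 0 <= (q - y) / (q - p) by rewrite divr_ge0 ?subr_ge0 ?(le_trans py).
  have k1 : (q - y) / (q - p) <= 1 by rewrite ler_pdivrMr// mul1r lerD2l lerN2.
  have := cB p q _ k0 k1 (AB _ Ap) (AB _ Aq); congr B.
  by field; rewrite gt_eqF.
pose B : set R := [set z | exists p q, [/\ A p, A q & p <= z <= q]].
apply: (hAy B); split => [|z Az]; last by exists z, z; rewrite lexx.
apply/convex_set_realP => x z k k0 k1.
move=> [p [q [Ap Aq pxq]]] [p' [q' [Ap' Aq' pzq']]].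
(* The combination lies between [x] and [z], so the lower bound of the smaller one and the upper
   bound of the larger one enclose it. *)
have [xz|zx] := leP x z; [exists p, q' | exists p', q]; split => //; nra.
Qed.

Lemma seq_min_max s : s != [::] ->
  exists p q, [/\ p \in s, q \in s & {in s, forall x, p <= x <= q}].
Proof.
elim: s => // a [|b s] IH _.
  by exists a, a; split=> [||x]; rewrite ?inE// => /eqP->; rewrite lexx.
have [p [q [ps qs pq]]] := IH isT.
exists (Num.min a p), (Num.max a q); split.
- by rewrite minEle; case: ifP; rewrite inE ?eqxx ?ps ?orbT.
- by rewrite maxEle; case: ifP; rewrite inE ?eqxx ?qs ?orbT.
- move=> x; rewrite inE => /orP[/eqP->|/pq/andP[px xq]].
    by rewrite ge_min lexx le_max lexx.
  by rewrite ge_min px le_max xq !orbT.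
Qed.

(** Peels off the last point, the form needed for inductions that extend an ordering on the
    right. *)
Lemma protrusive_rcons s y : s != [::] ->
  protrusive (rcons s y) <->
  protrusive s /\ ~ convex_hull [set x | x \in s] y.
Proof.
move=> s0; split=> [ps|[ps hy] i].
  split=> [i /andP[i0 ilt]|].
    have := ps i; rewrite size_rcons ltnS i0 (ltnW ilt) nth_rcons ilt => /(_ isT).
    by rewrite -cats1 takel_cat// ltnW.
  have := ps (size s); rewrite size_rcons ltnS leqnn lt0n size_eq0 s0 => /(_ isT).
  by rewrite nth_rcons ltnn eqxx -cats1 take_size_cat.
rewrite size_rcons ltnS => /andP[i0]; rewrite leq_eqVlt => /orP[/eqP->|ilt].
  by rewrite nth_rcons ltnn eqxx -cats1 take_size_cat.
by rewrite nth_rcons ilt -cats1 takel_cat ?(ltnW ilt)//; apply: ps; rewrite i0.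
Qed.

End ConvexHull.

Section SumOfDistances.
Local Open Scope ring_scope.
Variable R : realType.
Implicit Types (x y z p q : R) (s W : seq R).

(** A list stands for the multiset, so that points can be added by concatenation;
    [sum_dist_seq_mset] carries the result back to multisets. *)
Let D W x : R := \sum_(v <- W) `|x - v|.

(** Convexity with denominators cleared: the triangle inequality, applied to each [v] separately. *)
Lemma sum_dist_convex W a b y : a <= y <= b ->
  (b - a) * D W y <= (b - y) * D W a + (y - a) * D W b.
Proof.
move=> /andP[ay yb]; rewrite /D !mulr_sumr -big_split/=.
apply: ler_sum => v _.
have -> : (b - a) * `|y - v| = `|(b - y) * (a - v) + (y - a) * (b - v)|.
  have ab : 0 <= b - a by lra.
  by rewrite -[in LHS](ger0_norm ab) -normrM; congr Num.norm; ring.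
apply: (le_trans (ler_normD _ _)).
by rewrite !normrM (@ger0_norm _ (b - y)) ?(@ger0_norm _ (y - a)) ?subr_ge0.
Qed.

Lemma sum_dist_quasiconvex W a b y : a <= y <= b ->
  D W y <= D W a \/ D W y <= D W b.
Proof.
move=> ayb; have := sum_dist_convex W ayb.
have [|Day] := leP (D W y) (D W a); first by left.
have [|Dby] := leP (D W y) (D W b); first by right.
(* Once [a < y], the weight [y - a] of [D W b] is positive, so [D W y] exceeding both end values
   contradicts convexity. *)
have [eqya|neqya] := eqVneq y a; first by rewrite eqya ltxx in Day.
move: ayb => /andP[ay yb].
have {}ay : a < y by rewrite lt_neqAle eq_sym neqya.
by nra.
Qed.

Let ltD W : rel R := fun x y => D W x < D W y.

Let ltD_trans W : transitive (ltD W).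
Proof. by move=> ? ? ?; exact: lt_trans. Qed.

Lemma sorted_sum_dist_rcons W s y :
  sorted (ltD W) (rcons s y) = all (fun x => ltD W x y) s && sorted (ltD W) s.
Proof. by rewrite !(sorted_pairwise (@ltD_trans W)) pairwise_rcons. Qed.

Lemma sorted_sum_dist_protrusive W s : sorted (ltD W) s -> protrusive s.
Proof.
elim/last_ind: s => [_ i|s y IH]; first by rewrite ltn0 andbF.
have [->|s0] := eqVneq s [::]; first by move=> _ [|[]].
rewrite sorted_sum_dist_rcons => /andP[/allP sy /IH ps].
apply/protrusive_rcons => //; split=> // /convex_hull_realP[a [b [/= sa sb ayb]]].
by have [] := sum_dist_quasiconvex W ayb; rewrite leNgt => /negP[]; apply: sy.
Qed.

Lemma protrusive_sorted_sum_dist s : protrusive s ->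
  exists2 W, W != [::] & sorted (ltD W) s.
Proof.
(* With at most one point there is nothing to sort, so any nonempty list serves. *)
elim/last_ind: s => [_|s y IH ps]; first by exists [:: 0].
have [->|s0] := eqVneq s [::]; first by exists [:: 0].
move/(protrusive_rcons _ s0): ps => [/IH[W W0 sW] hy].
have [p [q [ps qs pq]]] := seq_min_max s0.
have ypq : ~~ (p <= y <= q).
  by apply/negP => ypq; apply: hy; apply/convex_hull_realP; exists p, q.
have pleq : p <= q by have /andP[] := pq _ ps.
(* A pair [p], [q] contributes exactly [q - p] on the segment and more outside it; the gap is what
   [y] gains on the earlier points per pair. *)
have gap : 0 < (`|y - p| + `|y - q|) - (q - p).
  have [py|yp] := leP p y; last by rewrite !ltr0_norm; lra.
  move: ypq; rewrite py -ltNge => qy.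
  by rewrite !ger0_norm; lra.
set g := (X in 0 < X) in gap.
have [N HN] : exists N : nat, forall x, x \in s -> D W x < D W y + g *+ N.
  have Ds0 : [seq D W x | x <- s] != [::] by rewrite -size_eq0 size_map size_eq0.
  have [m [M [_ _ HM]]] := seq_min_max Ds0.
  (* [M] is the largest value on [s]; by the Archimedean property this many gaps lift [D W y]
     strictly above [M]. *)
  exists (Num.bound `|(M - D W y) / g|) => x xs.
  have /andP[_ DM] := HM _ (map_f (D W) xs).
  have := archi_boundP (normr_ge0 ((M - D W y) / g)).
  rewrite -mulr_natr => /(le_lt_trans (ler_norm _)).
  by rewrite ltr_pdivrMr// mulrC; lra.
pose W' := W ++ flatten (nseq N [:: p; q]).
have DW' x : D W' x = D W x + (`|x - p| + `|x - q|) *+ N.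
  rewrite /D big_cat/=; congr (_ + _); elim: N {HN W'} => [|N IHN].
    by rewrite big_nil.
  by rewrite /= !big_cons IHN mulrS addrA.
have DW's x : x \in s -> D W' x = D W x + (q - p) *+ N.
  move=> /pq /andP[px xq]; rewrite DW' ger0_norm ?subr_ge0// ler0_norm ?subr_le0//.
  by congr (_ + _ *+ _); ring.
exists W'; first by rewrite -size_eq0 size_cat addn_eq0 size_eq0 (negPf W0).
rewrite sorted_sum_dist_rcons; apply/andP; split.
  apply/allP => x xs; rewrite /ltD (DW's _ xs) DW'.
  by move: (HN _ xs); rewrite /g mulrnBl; lra.
have eqD : {in mem s &, ltD W' =2 ltD W}.
  by move=> x z xs zs; rewrite /ltD !DW's// ltrD2r.
by rewrite (eq_in_sorted eqD)//; exact/allP.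
Qed.

End SumOfDistances.

Lemma sum_dist_seq_mset (R : realType) (W : seq R) :
  sum_dist (seq_mset W) =1 fun x => (\sum_(v <- W) `|x - v|)%R.
Proof. by move=> x; apply: perm_big; exact: perm_eq_seq_mset. Qed.

Lemma witnesses_distinguishes (R : realType) (V : {mset R}%mset) (C : {fset R})
  (s : seq R) : witnesses V C s -> distinguishes V C.
Proof.
move=> [/= sC sV] x y; rewrite -!(perm_mem sC) => xs ys Dxy.
have tr : transitive (fun x y => sum_dist V x < sum_dist V y)%R.
  by move=> ? ? ?; exact: lt_trans.
have lt i j := sorted_ltn_nth tr x sV i j.
(* Values increase strictly along [s], so points at different positions cannot have equal values. *)
case: (ltngtP (index x s) (index y s)) => [xy|yx|eqxy].
- by have := lt _ _ _ _ xy; rewrite !inE !index_mem !nth_index// Dxy ltxx => /(_ xs ys).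
- by have := lt _ _ _ _ yx; rewrite !inE !index_mem !nth_index// Dxy ltxx => /(_ ys xs).
- by rewrite -(nth_index x xs) eqxy nth_index.
Qed.

Lemma Psi_protrusive_orderings (R : realType) (C : {fset R}) :
  Psi C = protrusive_orderings C.
Proof.
apply/seteqP; split=> s.
  by move=> [V [_ _ [sC sV]]]; split=> //; exact: sorted_sum_dist_protrusive sV.
move=> [sC /protrusive_sorted_sum_dist[W W0 sW]].
have wW : witnesses (seq_mset W) C s.
  split=> //; rewrite (eq_sorted (e' := fun x y =>
    (\sum_(v <- W) `|x - v| < \sum_(v <- W) `|y - v|)%R))//.
  by move=> x y; rewrite !sum_dist_seq_mset.
exists (seq_mset W); split=> //; last exact: witnesses_distinguishes wW.
apply: contra W0 => /eqP W0.
by rewrite -size_eq0 -(perm_size (perm_eq_seq_mset W)) W0 enum_mset0.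
Qed.

(** Removing the last point, one of the two extremes of [t], leaves an arbitrary protrusive ordering
    of the remaining points, so the count doubles with each added point. *)
Lemma enum_protrusive (R : realType) (n : nat) (t : seq R) :
  uniq t -> size t = n.+1 ->
  exists l : seq (seq R), [/\ uniq l, size l = (2 ^ n)%N &
    forall s, s \in l <-> perm_eq s t /\ protrusive s].
Proof.
elim: n t => [|n IH] t ut st.
  case: t ut st => [|x [|]]// _ _; exists [:: [:: x]]; split=> // s.
  rewrite inE; split=> [/eqP->|[/perm_small_eq ->//]].
  by split=> // -[|[]].
have t0 : t != [::] by rewrite -size_eq0 st.
have [p [q [pt qt pq]]] := seq_min_max t0.
have neqpq : p != q.
  apply/negP => /eqP eqpq; have: (size t <= size [:: p])%N; last by rewrite st.
  apply: uniq_leq_size => // x /pq; rewrite -eqpq -eq_le inE.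
  by rewrite eq_sym.
have rem_t y : y \in t -> exists l : seq (seq R),
    [/\ uniq l, size l = (2 ^ n)%N &
      forall s, s \in l <-> perm_eq s (rem y t) /\ protrusive s].
  by move=> yt; apply: IH; rewrite ?rem_uniq// size_rem// st.
have rcons_perm (u : seq R) y : y \in t ->
    perm_eq (rcons u y) t = perm_eq u (rem y t).
  move=> yt; rewrite perm_rcons perm_sym (permPl (perm_to_rem yt)) perm_cons.
  by rewrite perm_sym.
have rcons_extreme (u : seq R) y : y \in [:: p; q] -> perm_eq u (rem y t) ->
    protrusive u -> protrusive (rcons u y).
  move=> ypq ut' pu; have yt : y \in t by move: ypq; rewrite !inE => /orP[] /eqP->.
  apply/protrusive_rcons; first by rewrite -size_eq0 (perm_size ut') size_rem// st.
  (* [a] and [b] are points of [t] other than [y], hence both strictly on the same side of the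
     extreme point [y]. *)
  split=> // /convex_hull_realP[a [b [/=]]].
  rewrite !(perm_mem ut') !mem_rem_uniq// !inE.
  move=> /andP[ay /pq apq] /andP[yb /pq bpq] ayb.
  move: ypq; rewrite !inE => /orP[] /eqP eqy; subst y.
    by move: ay; rewrite eq_le; lra.
  by move: yb; rewrite eq_le; lra.
have [lq [ulq slq lqP]] := rem_t q qt; have [lp [ulp slp lpP]] := rem_t p pt.
exists ([seq rcons u q | u <- lq] ++ [seq rcons u p | u <- lp]); split.
- rewrite cat_uniq !map_inj_uniq ?ulq ?ulp ?andbT//=; try exact: rcons_injl.
  (* The two families are disjoint because their last points differ. *)
  apply/hasPn => _ /mapP[u _ ->]; apply/mapP => -[v _ /rcons_inj[_ /eqP]].
  exact/negP.
- by rewrite size_cat !size_map slq slp addnn -mul2n expnS.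
move=> s; rewrite mem_cat; split.
  by move=> /orP[] /mapP[u /[swap] -> ] => [/lqP|/lpP] [pu uu];
     rewrite rcons_perm//; split=> //; apply: rcons_extreme; rewrite ?inE ?eqxx ?orbT.
case/lastP: s => [|u y] [pst ps]; first by move: (perm_size pst); rewrite st.
have yt : y \in t by rewrite -(perm_mem pst) mem_rcons mem_head.
move: pst; rewrite rcons_perm// => pu.
have u0 : u != [::] by rewrite -size_eq0 (perm_size pu) size_rem// st.
have [{}ps hy] := (protrusive_rcons _ u0).1 ps.
have [eqyq|neqyq] := eqVneq y q.
  by subst y; apply/orP; left; apply/mapP; exists u => //; apply/lqP.
have [eqyp|neqyp] := eqVneq y p.
  by subst y; apply/orP; right; apply/mapP; exists u => //; apply/lpP.
(* If [y] is neither extreme, both [p] and [q] come before it and their segment contains it. *)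
exfalso; apply: hy; apply/convex_hull_realP; exists p, q => /=.
rewrite !(perm_mem pu) !mem_rem_uniq// !inE pt qt !(eq_sym _ y) neqyq neqyp.
by split=> //; exact: pq.
Qed.

Theorem theorem7p2 (R : realType) (n : nat) (C : {fset R})
    (hn : (1 <= n)%N) (hC : (#|` C|)%fset = n) :
  Psi C = protrusive_orderings C /\
  protrusive_orderings C #= `I_(2 ^ n.-1)%N.
Proof.
split; first exact: Psi_protrusive_orderings.
have sC : size C = n.-1.+1 by rewrite prednK.
have [l [ul sl lP]] := enum_protrusive (fset_uniq C) sC.
have -> : protrusive_orderings C = [set` [fset s in l]%fset].
  by apply/seteqP; split=> s /=; rewrite inE => /lP.
by apply/card_eq_fsetP; rewrite card_fseq undup_id.
Qed.
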